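(* Let $0\le\alpha<1$ and let $n,d$ be integers with $2\le d\le n-1$. Let $G$ be a strongly connected simple digraph on $n$ vertices with clique number $d$. Then $\lambda_\alpha(G)\ge\lambda_\alpha(B_{n,d})$, with equality if and only if $G\cong B_{n,d}$.
   Context: All digraphs are simple. For a digraph $G$, $A(G)$ is the adjacency matrix, $D(G)$ the diagonal matrix of outdegrees, $A_\alpha(G)=\alpha D(G)+(1-\alpha)A(G)$, and $\lambda_\alpha(G)$ is the largest modulus of the eigenvalues of $A_\alpha(G)$. Strongly connected: for every ordered pair of vertices there is a directed path from the first to the second. The complete digraph $\overleftrightarrow{K_d}$ has arcs $(u,v)$ and $(v,u)$ for all distinct vertices $u,v$. A clique of $G$ is a set of vertices inducing a complete digraph; the clique number is the maximum size of a clique. $B_{n,d}$ is the digraph on vertices $v_1,\dots,v_n$ consisting of the complete digraph on $\{v_1\}\cup\{v_{n-d+2},\dots,v_n\}$ (which has $d$ vertices) together with the arcs of the directed path $v_1\to v_2\to\cdots\to v_{n-d+2}$. *)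

(* Defs.v *)
From mathcomp Require Import all_boot all_order all_algebra.
From mathcomp Require Import boolp classical_sets reals.
From mathcomp Require Import complex.
Set Implicit Arguments.
Unset Strict Implicit.
Unset Printing Implicit Defensive.

Import Order.TTheory GRing.Theory Num.Theory.
Local Open Scope ring_scope.

(* A simple digraph on a finite vertex type T is an irreflexive relation
   G : rel T, with G u v meaning that (u, v) is an arc. *)

Section Digraph.
Variables (T : finType) (G : rel T).

Definition strongly_connected : Prop := forall u v : T, connect G u v.

Definition clique (S : {set T}) : bool :=
  [forall u in S, forall v in S, (u != v) ==> G u v].

Definition clique_number : nat := (\max_(S : {set T} | clique S) #|S|)%N.

Definition outdegree (u : T) : nat := #|[set v | G u v]|.

End Digraph.

Definition digraph_iso (T U : finType) (G : rel T) (H : rel U) : Prop :=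
  exists2 f : T -> U, bijective f & forall u v, H (f u) (f v) = G u v.

Section Matrices.
Variables (R : realType) (T : finType) (G : rel T).

Definition adjmx : 'M[R]_#|T| :=
  \matrix_(i, j) (G (enum_val i) (enum_val j))%:R.

Definition outdegmx : 'M[R]_#|T| :=
  diag_mx (\row_i (outdegree G (enum_val i))%:R).

Definition Aalpha (alpha : R) : 'M[R]_#|T| :=
  alpha *: outdegmx + (1 - alpha) *: adjmx.

End Matrices.

Section SpectralRadius.
Variables (R : realType) (n : nat) (A : 'M[R]_n).

Definition eigenvalue_moduli : set R :=
  [set r | exists2 z : R[i],
     eigenvalue (map_mx (real_complex R) A) z & r = ComplexField.Normc.normc z]%classic.

(* The supremum is a maximum when 0 < n; see spectral_radius_max below. *)
Definition spectral_radius : R := sup eigenvalue_moduli.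

Lemma spectral_radius_max : (0 < n)%N ->
  eigenvalue_moduli spectral_radius /\
  (forall r, eigenvalue_moduli r -> r <= spectral_radius).
Proof.
move=> n0; set p := char_poly (map_mx (real_complex R) A).
have [s /= ps] := closed_field_poly_normal p.
have eE z : eigenvalue (map_mx (real_complex R) A) z = (z \in s).
  rewrite eigenvalue_root_char -/p ps rootZ ?root_prod_XsubC //.
  by rewrite (monicP (char_poly_monic _)) oner_neq0.
have s0 : s != [::].
  apply/eqP => s0; have := size_char_poly (map_mx (real_complex R) A).
  rewrite -/p ps s0 big_nil (monicP (char_poly_monic _)) scale1r size_poly1.
  by case=> n1; move: n0; rewrite -n1.
have [z zs zmax] : exists2 z, z \in s &
    forall y, y \in s -> ComplexField.Normc.normc y <= ComplexField.Normc.normc z.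
  elim: s s0 {ps eE} => // a [|b s] IH _.
    by exists a; rewrite ?mem_head // => y; rewrite inE => /eqP ->.
  have [//|z zs zm] := IH.
  have [az|za] := leP (ComplexField.Normc.normc a) (ComplexField.Normc.normc z).
    exists z; first by rewrite inE zs orbT.
    by move=> y; rewrite inE => /predU1P[->|/zm].
  exists a; first exact: mem_head.
  by move=> y; rewrite inE => /predU1P[->//|/zm/le_trans]; apply; exact: ltW.
have ub r : eigenvalue_moduli r -> r <= ComplexField.Normc.normc z.
  by case=> y; rewrite eE => ys ->; exact: zmax.
have mz : eigenvalue_moduli (ComplexField.Normc.normc z) by exists z; rewrite ?eE.
suff -> : spectral_radius = ComplexField.Normc.normc z by [].
apply/eqP; rewrite eq_le; apply/andP; split.
  by apply: ge_sup => //; exists (ComplexField.Normc.normc z).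
by apply: ub_le_sup => //; exists (ComplexField.Normc.normc z).
Qed.

End SpectralRadius.

Definition lambda (R : realType) (alpha : R) (T : finType) (G : rel T) : R :=
  spectral_radius (Aalpha G alpha).

(* The vertex v_k (1 <= k <= n) is encoded by the ordinal k - 1. *)
Definition Bdigraph (n d : nat) : rel 'I_n :=
  fun i j : 'I_n =>
    let inK (k : 'I_n) := (k == 0%N :> nat) || (n - d + 2 <= k.+1)%N in
    [&& i != j, inK i & inK j] ||
    ((j == i.+1 :> nat) && (j.+1 <= n - d + 2)%N).
Arguments Bdigraph n d : clear implicits.

(* Main.v *)
(* Let x be the Perron vector of B_{n,d}: it equals 1 on the clique except at
   the vertex v_1, where it is a > 1, and it decays like t^-j (t > 1) at distance
   j from the clique along the path.  In G choose a clique K of size d, a vertex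
   u of K with an out-neighbour w outside K, and transport x: put a at u and
   t^-(distance to K) elsewhere.  Distances to K are at most n - d, and every
   vertex outside K has an out-neighbour closer to K, so that
   A_alpha(G) x >= rho x with rho = lambda_alpha(B_{n,d}).  Pairing with a
   positive left Perron vector of A_alpha(G) gives lambda_alpha(G) >= rho, and
   equality forces A_alpha(G) x = rho x, i.e. no arcs besides those of B_{n,d}. *)
Require Import Defs.
From mathcomp Require Import boolp classical_sets topology normedtype derive.
From mathcomp Require Import all_boot all_order all_algebra.
From mathcomp Require Import reals complex zify ring lra.
Set Implicit Arguments.
Unset Strict Implicit.
Unset Printing Implicit Defensive.
Import Order.TTheory GRing.Theory Num.Theory.
Import numFieldNormedType.Exports.
Local Open Scope ring_scope.

(** * Perron-Frobenius theory for irreducible nonnegative kernels *)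

Lemma continuous_sumr (R : realType) (X : topologicalType) (J : Type)
    (r : seq J) (F : J -> X -> R) :
  (forall i, continuous (F i)) -> continuous (fun f => \sum_(i <- r) F i f).
Proof.
move=> cF; elim: r => [|i r IHr].
  by under eq_fun do rewrite big_nil; move=> f; exact: cvg_cst.
under eq_fun do rewrite big_cons.
by move=> f; apply: (@continuousD _ _ _ (F i)); [exact: cF|exact: IHr].
Qed.

(** Irreducibility in cut form, equivalent to strong connectivity of the digraph of positive
    entries. *)
Definition irreducible_kernel (R : realType) (I : finType) (M : I -> I -> R) :=
  forall S : {set I}, S != set0 -> S != setT ->
  exists i j, [/\ i \in S, j \notin S & 0 < M i j].

Section PerronFrobenius.
Variables (R : realType) (I : finType) (M : I -> I -> R).
Hypothesis M0 : forall i j, 0 <= M i j.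
Hypothesis Mirr : irreducible_kernel M.

Lemma exists_min_pos (P : pred I) (F : I -> R) : (forall i, P i -> 0 < F i) ->
  exists2 e : R, 0 < e & forall i, P i -> e <= F i.
Proof.
move=> F0; exists (\big[Order.min/1]_(i | P i) F i).
  by elim/big_ind: _ => // [x y x0 y0]; rewrite lt_min x0.
by move=> i Pi; exact: bigmin_le_cond.
Qed.

(* Raising [y] at a coordinate [i] with a strict inequality keeps it strict
   there for a small increment, and makes it strict at every [j] with
   [0 < M i j]; irreducibility lets strictness spread to all coordinates. *)
Lemma subinvariant_strict (s : R) (y : I -> R) :
  0 <= s -> (forall i, 0 <= y i) -> (exists i, 0 < y i) ->
  (forall j, s * y j <= \sum_i y i * M i j) ->
  (exists j, s * y j < \sum_i y i * M i j) ->
  exists y' : I -> R, [/\ forall i, 0 <= y' i, exists i, 0 < y' i &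
    forall j, s * y' j < \sum_i y' i * M i j].
Proof.
move=> s0; pose N (y : I -> R) := [set j | s * y j < \sum_i y i * M i j].
have [k] := ubnP #|~: N y|; elim: k y => // k IH y /ltnSE yk y0 [i0 yi0] yM [j0 yj0].
have [NT|NT] := eqVneq (N y) setT.
  exists y; split => //; first by exists i0.
  by move=> j; have : j \in N y by [rewrite NT inE]; rewrite inE.
have Nn0 : N y != set0 by apply/set0Pn; exists j0; rewrite inE.
have [i [j [iN jN Mij]]] := Mirr Nn0 NT.
have ijn : i != j by apply: contraNneq jN => <-.
pose z := \sum_i y i * M i i; move: (iN); rewrite inE => zi.
(* Dividing the slack at [i] by [s + 1] allows [s = 0] and makes [e * s] smaller than that slack. *)
pose e := (\sum_i0 y i0 * M i0 i - s * y i) / (s + 1).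
have e0 : 0 < e by rewrite divr_gt0 ?subr_gt0 // ltr_wpDl.
have es : e * s < \sum_i0 y i0 * M i0 i - s * y i.
  have : e * (s + 1) = \sum_i0 y i0 * M i0 i - s * y i.
    by rewrite divfK // gt_eqF // ltr_wpDl.
  by move=> <-; rewrite mulrDr mulr1 ltrDl.
pose y' l := y l + (if l == i then e else 0).
have y'E l : \sum_i0 y' i0 * M i0 l = \sum_i0 y i0 * M i0 l + e * M i l.
  under eq_bigr do rewrite mulrDl.
  rewrite big_split /=; congr (_ + _).
  rewrite (bigD1 i) //= eqxx big1 ?addr0 // => l' /negbTE ->.
  by rewrite mul0r.
have y'N l : l \in N y -> l \in N y'.
  rewrite !inE y'E /y'; have [->|li] := eqVneq l i => h.
    by have := mulr_ge0 (ltW e0) (M0 i i); lra.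
  by have := mulr_ge0 (ltW e0) (M0 i l); lra.
have y'j : j \in N y'.
  rewrite !inE y'E /y' eq_sym (negbTE ijn) addr0.
  by rewrite (le_lt_trans (yM j)) // ltrDl mulr_gt0.
apply: (IH y').
- apply: leq_trans yk; apply: proper_card.
  apply/properP; split; last by exists j; rewrite inE ?y'j ?jN.
  by apply/subsetP => l; rewrite !inE; apply: contraNN; have := y'N l; rewrite !inE.
- by move=> l; rewrite addr_ge0 //; case: ifP => // _; exact: ltW.
- by exists i; rewrite /y' eqxx ltr_wpDl.
- move=> l; have [/y'N|lN] := boolP (l \in N y); first by rewrite inE => /ltW.
  rewrite y'E /y' ifN; last by apply: contraNneq lN => ->.
  by rewrite addr0 (le_trans (yM l)) // lerDl mulr_ge0 // ltW.
- by exists j; move: y'j; rewrite inE.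
Qed.

(** Collatz-Wielandt by compactness: the pairs of a rate [s] and a subinvariant [y] in the simplex
    form a closed subset of a compact box, on which the rate attains its maximum. *)
Lemma exists_subinvariant_max : (0 < #|I|)%N ->
  exists s : R, exists y : I -> R,
  [/\ 0 <= s, forall i, 0 <= y i, \sum_i y i = 1,
      forall j, s * y j <= \sum_i y i * M i j &
      forall (s' : R) (y' : I -> R), 0 <= s' -> (forall i, 0 <= y' i) ->
        \sum_i y' i = 1 ->
        (forall j, s' * y' j <= \sum_i y' i * M i j) -> s' <= s].
Proof.
(* A point of [X] packs such a pair: coordinate [None] is the rate, coordinate [Some i] is [y i]. *)
move=> /card_gt0P [k0 _]; pose X := prod_topology (fun _ : option I => R).
pose C := \sum_i \sum_j M i j.
have C0 : 0 <= C by apply: sumr_ge0 => i _; apply: sumr_ge0 => j _.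
pose itv (o : option I) : set R :=
  if o is None then `[0, C]%classic else `[0, 1]%classic.
pose box := [set f : X | forall o, itv o (f o)]%classic.
pose simplex := [set f : X | \sum_i f (Some i) = 1]%classic.
pose sub j := [set f : X | 0 <= \sum_i f (Some i) * M i j - f None * f (Some j)]%classic.
pose A := (box `&` (simplex `&` \bigcap_j sub j))%classic.
have cbox : compact box.
  apply: (@tychonoff _ (fun _ : option I => R) itv).
  by case=> [i|]; exact: segment_compact.
have cp o : continuous (fun f : X => f o) by exact: proj_continuous.
have cA : compact A.
  apply: compact_closedI => //; apply: closedI.
    apply: (@preimage_closed _ _ (fun f : X => \sum_i f (Some i))
      [set x | x = 1]%classic).
      by move=> f _; apply: continuous_sumr => i; exact: cp.
    exact: closed_eq.
  apply: closed_bigI => j _.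
  apply: (@preimage_closed _ _ 
    (fun f : X => \sum_i f (Some i) * M i j - f None * f (Some j))
    [set x | 0 <= x]%classic); last exact: closed_ge.
  move=> f _; apply: (@continuousB _ _ _ (fun f : X => \sum_i f (Some i) * M i j)
    (fun f : X => f None * f (Some j))); last first.
    apply: (@continuousM _ _ (fun f : X => f None) (fun f : X => f (Some j)));
      exact: cp.
  apply: continuous_sumr => i g.
  apply: (@continuousM R X (fun f : X => f (Some i)) (fun=> M i j) g).
    exact: (cp (Some i) g).
  exact: (@cst_continuous X R (M i j) g).
have A0 : (A !=set0)%classic.
  exists (fun o => if o is Some i then (i == k0)%:R else 0); split; [|split].
  - by case=> [i|] /=; rewrite in_itv /= ?lexx ?C0 // ler0n lern1 leq_b1.
  - rewrite /simplex /= (bigD1 k0) //= eqxx big1 ?addr0 // => i /negbTE ->; exact: erefl.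
  - move=> j _; rewrite /sub /= mul0r subr0; apply: sumr_ge0 => i _.
    by rewrite mulr_ge0.
have cN : {within A, continuous (fun f : X => f None)}%classic.
  by apply: continuous_subspaceT; exact: cp.
have [f fA fmax] := compact_EVT_max A0 cA cN.
have [fbox [fsum fsub]] := set_mem fA.
exists (f None), (fun i => f (Some i)); split=> //.
- by have := fbox None; rewrite /= in_itv /= => /andP[].
- by move=> i; have := fbox (Some i); rewrite /= in_itv /= => /andP[].
- by move=> j; have := fsub j Logic.I; rewrite /sub /= subr_ge0.
move=> s' y' s'0 y'0 y'1 y's'.
have y'le i : y' i <= 1.
  by rewrite -y'1 (bigD1 i) //= lerDl sumr_ge0.
pose g : X := fun o => if o is Some i then y' i else s'.
have gA : g \in A.
  apply: mem_set; split; last first.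
    by split=> // j _; rewrite /sub /= subr_ge0.
  case=> [i|] /=; rewrite in_itv /=; first by rewrite y'0 y'le.
  (* Summing the inequalities over all [j] bounds every admissible rate by [C], because
     [y' i <= 1]. *)
  rewrite s'0 /= -[s']mulr1 -y'1 mulr_sumr.
  rewrite (le_trans (ler_sum _ (fun j _ => y's' j))) // exchange_big.
  apply: ler_sum => i _; apply: ler_sum => j _.
  by rewrite -[leRHS]mul1r ler_wpM2r.
exact: fmax gA.
Qed.

(** At the maximal rate every inequality is an equality: a strict one would spread to all
    coordinates and leave room for a larger rate. If the support of [y] were proper, an entry
    leaving it would give a positive sum at a coordinate where [y] vanishes. *)
Lemma perron_left_eigenvector : (0 < #|I|)%N ->
  exists s : R, exists y : I -> R,
  [/\ 0 <= s, forall i, 0 < y i & forall j, \sum_i y i * M i j = s * y j].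
Proof.
move=> I0; have [s [y [s0 y0 y1 ys smax]]] := exists_subinvariant_max I0.
have ypos : exists i, 0 < y i.
  apply/existsP; apply: contraTT isT => /existsPn yN.
  have: \sum_i y i = 0; last by rewrite y1 => /eqP; rewrite oner_eq0.
  by apply: big1 => i _; apply/eqP; rewrite eq_le y0 leNgt yN.
have yE j : \sum_i y i * M i j = s * y j.
  apply/eqP; rewrite eq_le ys andbT leNgt; apply/negP => ltj.
  have [] := subinvariant_strict s0 y0 ypos ys; first by exists j.
  move=> y' [y'0 [i0 y'i0] y'lt].
  have S0 : 0 < \sum_i y' i by rewrite (bigD1 i0) //= ltr_pwDl ?sumr_ge0.
  (* A uniform lower bound [e] on these quotients lets the rate grow to [s + e]; the [+ 1] guards
     against [y' j = 0]. *)
  pose F j := (\sum_i y' i * M i j - s * y' j) / (y' j + 1).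
  have [|e e0 eF] := @exists_min_pos predT F.
    by move=> l _; rewrite divr_gt0 ?subr_gt0 // ltr_wpDl.
  have : s + e <= s; last by rewrite gerDl leNgt e0.
  apply: (smax _ (fun i => y' i / \sum_i y' i)).
  - by rewrite addr_ge0 // ltW.
  - by move=> i; rewrite divr_ge0 // ltW.
  - by rewrite -mulr_suml divff // gt_eqF.
  - move=> l /=; under [leRHS]eq_bigr do rewrite mulrAC.
    rewrite -mulr_suml mulrA ler_pM2r ?invr_gt0 // mulrDl.
    have := eF l isT; rewrite /F ler_pdivlMr ?ltr_wpDl //.
    have := mulr_ge0 (ltW e0) (y'0 l); lra.
exists s, y; split=> //.
pose S := [set i | 0 < y i].
have S0 : S != set0 by case: ypos => i yi; apply/set0Pn; exists i; rewrite inE.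
have [ST|ST] := eqVneq S setT.
  by move=> i; have : i \in S by [rewrite ST inE]; rewrite inE.
have [i [j [iS jS Mij]]] := Mirr S0 ST.
have yj : y j = 0 by move: jS; rewrite inE -leNgt => yj; apply/eqP; rewrite eq_le yj y0.
have := yE j; rewrite yj mulr0 (bigD1 i) //= => /eqP.
rewrite inE in iS.
rewrite gt_eqF // ltr_pwDl ?mulr_gt0 //.
by apply: sumr_ge0 => l _; rewrite mulr_ge0.
Qed.

End PerronFrobenius.

(** * The matrix of a digraph as a kernel, and bounds on its spectral radius *)

Lemma strongly_connected_exit (T : finType) (G : rel T) (S : {set T}) :
  strongly_connected G -> S != set0 -> S != setT ->
  exists u v, [/\ u \in S, v \notin S & G u v].
Proof.
move=> Gsc /set0Pn[u uS]; rewrite -subTset => /subsetPn[v _ vS].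
have [p Gp vp] := connectP (Gsc u v).
elim: p u uS Gp vp => [|w p IH] u uS /=; first by move=> _ uv; rewrite uv uS in vS.
case/andP=> Guw Gp vp; have [wS|wS] := boolP (w \in S); first exact: (IH w).
by exists u, w.
Qed.

Section AlphaKernel.
Variables (R : realType) (alpha : R).

Definition alpha_kernel (T : finType) (G : rel T) (u v : T) : R :=
  alpha * ((outdegree G u)%:R *+ (u == v)) + (1 - alpha) * (G u v)%:R.

(** The product of the matrix with [x] at [u]. The diagonal outdegree is spread over the
    out-neighbours, so each arc contributes one term of its own. *)
Definition alpha_action (T : finType) (G : rel T) (x : T -> R) (u : T) : R :=
  \sum_(v | G u v) (alpha * x u + (1 - alpha) * x v).

Lemma AalphaE (T : finType) (G : rel T) i j :
  Aalpha G alpha i j = alpha_kernel G (enum_val i) (enum_val j).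
Proof.
rewrite !mxE /alpha_kernel; do ?congr (_ + _ * (_ *+ _)).
by rewrite (inj_eq enum_val_inj).
Qed.

Lemma alpha_kernel_ge0 (T : finType) (G : rel T) u v :
  0 <= alpha < 1 -> 0 <= alpha_kernel G u v.
Proof.
move=> /andP[a0 a1].
by rewrite addr_ge0 // mulr_ge0 ?subr_ge0 ?ler0n ?mulrn_wge0 // ltW.
Qed.

Lemma alpha_kernel_action (T : finType) (G : rel T) (x : T -> R) u :
  \sum_v alpha_kernel G u v * x v = alpha_action G x u.
Proof.
rewrite /alpha_action big_split /= sumr_const -mulr_sumr.
under eq_bigr do rewrite mulrDl.
rewrite big_split /=; congr (_ + _).
  rewrite (bigD1 u) //= eqxx mulr1n big1 ?addr0 => [|v /negbTE].
    by rewrite /outdegree cardsE -mulrA [_ * x u]mulrC mulrA mulr_natr.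
  by rewrite eq_sym => ->; rewrite mulr0n mulr0 mul0r.
rewrite [in RHS]big_mkcond mulr_sumr; apply: eq_bigr => v _.
by rewrite -mulrA; case: (G u v); rewrite ?mul1r ?mul0r.
Qed.

(** Eigenvectors are row vectors here, so [f] multiplies the kernel from the left. *)
Lemma Aalpha_eigenvalueP (T : finType) (G : rel T) (z : R[i]) :
  eigenvalue (map_mx (real_complex R) (Aalpha G alpha)) z <->
  exists2 f : T -> R[i], exists u, f u != 0 &
    forall v, \sum_u f u * (alpha_kernel G u v)%:C%C = z * f v.
Proof.
split=> [/eigenvalueP[w wA w0]|[f [u fu] fE]].
  exists (fun u => w 0 (enum_rank u)).
    by have [i wi] := rV0Pn _ w0; exists (enum_val i); rewrite enum_valK.
  move=> v; have := congr1 (fun w : 'rV__ => w 0 (enum_rank v)) wA.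
  rewrite !mxE => <-; rewrite (reindex (@enum_val _ T)) /=; last first.
    by exists enum_rank => ? _; rewrite ?enum_valK ?enum_rankK.
  by apply: eq_bigr => i _; rewrite enum_valK [map_mx _ _ _ _]mxE AalphaE enum_rankK.
apply/eigenvalueP; exists (\row_i f (enum_val i)); last first.
  by apply/rV0Pn; exists (enum_rank u); rewrite mxE enum_rankK.
apply/rowP => j; rewrite !mxE -fE [RHS](reindex (@enum_val _ T)) /=; last first.
  by exists enum_rank => ? _; rewrite ?enum_valK ?enum_rankK.
by apply: eq_bigr => i _; rewrite [map_mx _ _ _ _]mxE AalphaE mxE.
Qed.

Lemma normc_real (r : R) : ComplexField.Normc.normc (r%:C)%C = `|r|.
Proof. by rewrite /ComplexField.Normc.normc /= expr0n addr0 sqrtr_sqr. Qed.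

Lemma lambda_max (T : finType) (G : rel T) : (0 < #|T|)%N ->
  eigenvalue_moduli (Aalpha G alpha) (lambda alpha G) /\
  (forall r, eigenvalue_moduli (Aalpha G alpha) r -> r <= lambda alpha G).
Proof. exact: spectral_radius_max. Qed.

Lemma lambda_iso (T U : finType) (G : rel T) (H : rel U) : (0 < #|T|)%N ->
  digraph_iso G H -> lambda alpha G = lambda alpha H.
Proof.
move=> T0 [f bf fE]; have [g gK fK] := bf.
have U0 : (0 < #|U|)%N by rewrite -(bij_eq_card bf).
have gE u v : G (g u) (g v) = H u v by rewrite -fE !fK.
have kE (V W : finType) (K : rel V) (L : rel W) (h : V -> W) : bijective h ->
    (forall u v, L (h u) (h v) = K u v) ->
    forall u v, alpha_kernel L (h u) (h v) = alpha_kernel K u v.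
  move=> bh hE u v; rewrite /alpha_kernel hE (inj_eq (bij_inj bh)).
  congr (_ * (_%:R *+ _) + _); rewrite /outdegree -(card_imset _ (bij_inj bh)).
  have [h' hK h'K] := bh; congr #|pred_of_set _|; apply/setP => w.
  rewrite -[w]h'K inE hE (mem_imset _ _ (bij_inj bh)) inE //.
(* Eigenvectors pull back along an isomorphism. This gives one inequality, applied below to [f] and
   to its inverse. *)
have le (V W : finType) (K : rel V) (L : rel W) (h : V -> W) : (0 < #|V|)%N ->
    (0 < #|W|)%N -> bijective h ->
    (forall u v, L (h u) (h v) = K u v) -> lambda alpha L <= lambda alpha K.
  move=> V0 W0 bh hE; have [[z zL ->] _] := lambda_max L W0.
  apply: (lambda_max K V0).2; exists z => //.
  have [y [w yw] yE] := (Aalpha_eigenvalueP L z).1 zL.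
  have [h' hK h'K] := bh.
  apply/Aalpha_eigenvalueP; exists (y \o h).
    by exists (h' w); rewrite /= h'K.
  move=> v; rewrite /= -yE [RHS](reindex h) /=; last exact: onW_bij.
  by apply: eq_bigr => u _; rewrite (kE _ _ K L).
apply/eqP; rewrite eq_le (le _ _ H G g) ?(le _ _ G H f) //.
by exists f.
Qed.

(** For a left eigenvector of an eigenvalue of maximal modulus, the triangle inequality makes the
    vector of moduli subinvariant; pairing it with the positive [x] compares the modulus with
    [rho]. *)
Lemma lambda_le_superaction (T : finType) (G : rel T) (x : T -> R) (rho : R) :
  0 <= alpha < 1 -> (0 < #|T|)%N -> (forall u, 0 < x u) ->
  (forall u, alpha_action G x u <= rho * x u) -> lambda alpha G <= rho.
Proof.
move=> al T0 x0 xrho; have [[z zG ->] _] := lambda_max G T0.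
have [f [w fw] fE] := (Aalpha_eigenvalueP G z).1 zG.
pose N (c : R[i]) : R := ComplexField.Normc.normc c.
have ker0 u v := alpha_kernel_ge0 G u v al.
have N0 c : 0 <= N c by case: c => p q; exact: sqrtr_ge0.
have NE v : N z * N (f v) <= \sum_u N (f u) * alpha_kernel G u v.
  rewrite -ComplexField.Normc.normcM -fE.
  apply: (@le_trans _ _ (\sum_u N (f u * (alpha_kernel G u v)%:C%C))).
    elim/big_rec2: _ => [|i p q _ IH]; first by rewrite /N ComplexField.Normc.normc0.
    by rewrite (le_trans (le_normcD _ _)) // lerD2l.
  apply: ler_sum => u _; rewrite /N ComplexField.Normc.normcM normc_real ger0_norm //.
have S0 : 0 < \sum_v N (f v) * x v.
  rewrite (bigD1 w) //= ltr_pwDl ?sumr_ge0 // => [|v _]; last by rewrite mulr_ge0 // ltW.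
  rewrite mulr_gt0 // lt_def N0 andbT.
  by apply: contraNneq fw => /ComplexField.Normc.eq0_normc ->.
rewrite -(ler_pM2r S0) mulr_sumr.
apply: (@le_trans _ _ (\sum_v (\sum_u N (f u) * alpha_kernel G u v) * x v)).
  apply: ler_sum => v _; rewrite mulrA ler_pM2r //.
under eq_bigr do rewrite mulr_suml.
rewrite exchange_big /= mulr_sumr; apply: ler_sum => u _.
under eq_bigr do rewrite -mulrA.
by rewrite -mulr_sumr alpha_kernel_action mulrCA ler_wpM2l.
Qed.

(** Pairing with a positive left Perron vector [y] of eigenvalue [s] turns the total weighted slack
    into [s - rho] times a positive number. Hence [rho <= s], and when [s = rho] each nonnegative
    slack vanishes. *)
Lemma lambda_ge_subaction (T : finType) (G : rel T) (x : T -> R) (rho : R) :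
  0 <= alpha < 1 -> (0 < #|T|)%N -> strongly_connected G ->
  (forall u, 0 < x u) ->
  (forall u, rho * x u <= alpha_action G x u) ->
  rho <= lambda alpha G /\
  (lambda alpha G <= rho -> forall u, alpha_action G x u = rho * x u).
Proof.
move=> al T0 Gsc x0 xrho; have /andP[a0 a1] := al.
have ker0 u v := alpha_kernel_ge0 G u v al.
have irr : irreducible_kernel (alpha_kernel G).
  move=> S S0 ST; have [u [v [uS vS Guv]]] := strongly_connected_exit Gsc S0 ST.
  exists u, v; split=> //; rewrite /alpha_kernel Guv mulr1.
  by rewrite ltr_wpDl ?subr_gt0 // mulr_ge0 ?mulrn_wge0.
have [s [y [s0 y0 yE]]] := perron_left_eigenvector ker0 irr T0.
have sl : s <= lambda alpha G.
  have [_ maxl] := lambda_max G T0.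
  have [u _] := card_gt0P T0.
  apply: maxl; exists (s%:C)%C; last by rewrite normc_real ger0_norm.
  apply/Aalpha_eigenvalueP; exists (fun u => (y u)%:C%C).
    by exists u; rewrite gt_eqF // ltcR.
  move=> v; rewrite -rmorphM /= -yE rmorph_sum; apply: eq_bigr => w _.
  by rewrite -rmorphM.
have xyE : \sum_u y u * (alpha_action G x u - rho * x u) = (s - rho) * \sum_u y u * x u.
  under eq_bigr do rewrite mulrBr.
  rewrite sumrB mulrBl !mulr_sumr; congr (_ - _); last first.
    by apply: eq_bigr => u _; rewrite mulrCA.
  under eq_bigr do rewrite -alpha_kernel_action mulr_sumr.
  rewrite exchange_big /=; apply: eq_bigr => v _.
  under eq_bigr do rewrite mulrA.
  by rewrite -mulr_suml yE mulrA.
have xy0 : 0 < \sum_u y u * x u.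
  have [u _] := card_gt0P T0.
  rewrite (bigD1 u) //= ltr_pwDl ?mulr_gt0 // sumr_ge0 // => v _.
  by rewrite mulr_ge0 // ltW.
have t0 u : 0 <= y u * (alpha_action G x u - rho * x u).
  by rewrite mulr_ge0 ?subr_ge0 // ltW.
have srho : rho <= s.
  by rewrite -subr_ge0 -(pmulr_lge0 _ xy0) -xyE sumr_ge0.
split; first exact: le_trans sl.
move=> lrho u; have sE : s = rho by apply/eqP; rewrite eq_le srho (le_trans sl).
move/eqP: xyE; rewrite sE subrr mul0r psumr_eq0 // => /allP /(_ u).
rewrite mem_index_enum mulf_eq0 gt_eqF //= subr_eq0.
by move=> /(_ isT) /eqP.
Qed.

End AlphaKernel.

(** * Heights above a clique *)

Definition descent (T : finType) (G : rel T) (K : {set T}) (h : T -> nat) :=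
  (forall v, (h v == 0%N) = (v \in K)) /\
  (forall v k, h v = k.+1 -> exists2 w, G v w & h w = k).

(** The height of [v] is the least length of a walk from [v] into [K]; [reach v k] asks for a walk
    of exactly [k] arcs. *)
Lemma exists_descent (T : finType) (G : rel T) (K : {set T}) :
  strongly_connected G -> K != set0 -> exists h, descent G K h.
Proof.
move=> Gsc /set0Pn[u uK].
pose reach v k := [exists w in K, [exists p : k.-tuple T, path G v p && (last v p == w)]].
have reachP v : exists k, reach v k.
  have [p Gp up] := connectP (Gsc v u); exists (size p).
  apply/exists_inP; exists u => //; apply/existsP; exists (in_tuple p).
  by rewrite /= Gp up eqxx.
have reach0 v : reach v 0%N = (v \in K).
  apply/exists_inP/idP => [[w wK /existsP[p]]|vK].
    by rewrite tuple0 /= => /eqP ->.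
  by exists v => //; apply/existsP; exists [tuple] => /=.
have reachS v k : reach v k.+1 -> exists2 w, G v w & reach w k.
  move=> /exists_inP[w wK /existsP[p]].
  case/tupleP: p => v' p /= /andP[/andP[Gvv' Gp] pw]; exists v' => //.
  by apply/exists_inP; exists w => //; apply/existsP; exists p; rewrite Gp.
have reachG v w k : G v w -> reach w k -> reach v k.+1.
  move=> Gvw /exists_inP[w' wK /existsP[p Gp]].
  apply/exists_inP; exists w' => //; apply/existsP; exists [tuple of w :: p].
  by rewrite /= Gvw.
exists (fun v => ex_minn (reachP v)); split=> [v|v k].
  case: ex_minnP => k vk kmin; rewrite -reach0.
  by apply/eqP/idP => [<- //|/kmin]; rewrite leqn0 => /eqP.
case: ex_minnP => k' vk kmin ek; rewrite {k'}ek in vk kmin.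
have [w Gvw wk] := reachS _ _ vk; exists w => //.
case: ex_minnP => l wl lmin; apply/eqP; rewrite eqn_leq lmin //=.
by have := kmin _ (reachG _ _ _ Gvw wl).
Qed.

Section Descent.
Variables (T : finType) (G : rel T) (K : {set T}) (h : T -> nat).
Hypothesis hP : descent G K h.

(** Descending from [v] one step at a time meets each of these heights, and a positive height is
    only taken outside [K]. *)
Lemma descent_iota v :
  {subset iota 1 (h v) <= [seq h w | w <- enum (~: K)]}.
Proof.
have [h0 hS] := hP.
have surj k : forall v, (k <= h v)%N -> exists w, h w = k.
  move=> w; move: {2}(h w) (leqnn (h w)) => l.
  elim: l w => [|l IH] w wl kw; first by exists w; lia.
  have [//|] := eqVneq (h w) k; first by exists w.
  case hw: (h w) => [|l'] hk; first by lia.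
  by have [w' _ hw'] := hS _ _ hw; apply: (IH w'); lia.
move=> k; rewrite mem_iota => /andP[k1 kv].
have [|w hw] := surj k v; first by lia.
apply/mapP; exists w => //; rewrite mem_enum inE -h0 hw.
by case: k k1 {kv hw}.
Qed.

Lemma descent_leq v : (h v <= #|~: K|)%N.
Proof.
have := uniq_leq_size (iota_uniq _ _) (@descent_iota v).
by rewrite size_iota size_map -cardE.
Qed.

(** If the largest possible height occurs, the vertices outside [K] are just numerous enough to
    cover all heights, so each height occurs once. *)
Lemma descent_inj v : h v = #|~: K| -> {in ~: K &, injective h}.
Proof.
move=> hv; apply/dinjectiveP.
apply: leq_size_uniq (iota_uniq _ _) (@descent_iota v) _.
by rewrite size_map size_iota -cardE hv.
Qed.

End Descent.

(** * Existence of the Perron parameters *)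

(* The equations satisfied by a Perron vector of [Bdigraph n d] with entries
   [a] at [v_1], [1] on the rest of the clique and [t ^- j] at distance [j] from
   the clique along the path ([m = n - d]), for the eigenvalue
   [alpha + (1 - alpha) * t]. *)
Definition perron_parameters (R : realType) (alpha : R) (d m : nat) (t a : R) :=
  [/\ 1 < t, 1 < a,
      (d%:R - 1) * alpha + (1 - alpha) * (a + d%:R - 2) = alpha + (1 - alpha) * t &
      (d%:R - 1) * (alpha * a + (1 - alpha)) + (alpha * a + (1 - alpha) * t ^- m)
        = (alpha + (1 - alpha) * t) * a].

(** Eliminating [a] leaves one polynomial equation in [t], solved by the intermediate value
    theorem. *)
Lemma exists_perron_parameters (R : realType) (alpha : R) (d m : nat) :
  0 <= alpha < 1 -> (2 <= d)%N -> exists t a, perron_parameters alpha d m t a.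
Proof.
move=> /andP[al0 al1] d2; pose D : R := d%:R.
have D2 : 2 <= D by rewrite /D ler_nat.
have b0 : 0 < 1 - alpha by rewrite subr_gt0.
(* The eigenvalue [alpha + (1 - alpha) * t] is [d - 1] at [t0], as for the complete digraph on [d]
   vertices, and [d] at [t1]. *)
pose t0 := (D - 1 - alpha) / (1 - alpha).
pose t1 := (D - alpha) / (1 - alpha).
have t0E : (1 - alpha) * t0 = D - 1 - alpha by rewrite mulrC divfK // gt_eqF.
have t1E : (1 - alpha) * t1 = D - alpha by rewrite mulrC divfK // gt_eqF.
have t01 : t0 <= t1 by rewrite ler_pM2r ?invr_gt0 //; lra.
have t0ge1 : 1 <= t0 by rewrite ler_pdivlMr // mul1r; lra.
(* With [a = t + 1 - t0] the third equation holds, and the last one multiplied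
   by [t ^+ m] reads [p.[t] = 0]. *)
pose q := (alpha%:P + (1 - alpha) *: 'X - (alpha * D)%:P) * ('X + (1 - t0)%:P)
  - ((1 - alpha) * (D - 1))%:P.
pose p := 'X^m * q - (1 - alpha)%:P.
have qE t : q.[t] = (alpha + (1 - alpha) * t - alpha * D) * (t + (1 - t0))
    - (1 - alpha) * (D - 1).
  by rewrite /q !hornerE.
have pE t : p.[t] = t ^+ m * q.[t] - (1 - alpha) by rewrite /p !(hornerE, hornerXn).
have p0 : p.[t0] < 0.
  rewrite pE qE t0E.
  have -> : (alpha + (D - 1 - alpha) - alpha * D) * (t0 + (1 - t0))
    - (1 - alpha) * (D - 1) = - alpha by ring.
  have : 0 <= t0 ^+ m * alpha by rewrite mulr_ge0 // exprn_ge0 //; lra.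
  by lra.
have p1 : 0 <= p.[t1].
  have Q1 : 1 - alpha <= q.[t1].
    have e : (1 - alpha) * (t1 + (1 - t0)) = 2 - alpha.
      by rewrite mulrDr mulrBr t1E t0E; lra.
    rewrite qE t1E.
    have -> : (alpha + (D - alpha) - alpha * D) * (t1 + (1 - t0)) =
      D * ((1 - alpha) * (t1 + (1 - t0))) by ring.
    rewrite e; lra.
  rewrite pE subr_ge0 (le_trans Q1) // ler_peMl //; first by lra.
  by rewrite exprn_ege1 //; lra.
have [|t /andP[tt0 tt1] /rootP pt] := @poly_ivt _ p _ _ t01.
  by rewrite (ltW p0) p1.
(* The strict sign at [t0] excludes [t = t0]; this yields both [t > 1] and [a > 1]. *)
have t_t0 : t0 < t.
  by rewrite lt_def tt0 andbT; apply: contraTneq p0 => <-; rewrite pt ltxx.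
have t1' : 1 < t by lra.
have tm : t ^+ m != 0 by rewrite expf_neq0 // gt_eqF //; lra.
exists t, (t + (1 - t0)); split=> //; first by lra.
  by rewrite -/D; lra.
have : t ^- m * p.[t] = 0 by rewrite pt mulr0.
rewrite pE qE mulrBr mulrA mulVf // mul1r -/D; lra.
Qed.

(** * The test vector, its inequality and the equality case *)

(* [h] is the distance to the clique [K]; the tail leaves [K] at [u] and returns
   to [K] at another vertex, through one vertex of each height. *)
Definition clique_with_tail (T : finType) (G : rel T) (K : {set T}) (u : T)
    (h : T -> nat) :=
  [/\ u \in K, {in K &, forall v w, G v w = (v != w)},
      forall v w, v \in K -> w \notin K -> G v w = (v == u) && (h w == #|~: K|),
      forall v, v \notin K ->
        exists y, [/\ y != u, h v = (h y).+1 & forall w, G v w = (w == y)] &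
      [/\ forall v, (h v == 0%N) = (v \in K), {in ~: K &, injective h} &
          exists2 w, w \notin K & h w = #|~: K|]].

(** Any further positive term would push the sum above [b]. In the equality case this excludes extra
    arcs. *)
Lemma sumr_eq_single (R : numDomainType) (T : finType) (P : pred T)
    (F : T -> R) (b : R) (w0 : T) :
  (forall w, P w -> 0 < F w) -> P w0 -> b <= F w0 -> \sum_(w | P w) F w = b ->
  F w0 = b /\ P =1 pred1 w0.
Proof.
move=> F0 Pw0 bF; rewrite (bigD1 w0) //= => Fb.
have r0 : 0 <= \sum_(w | P w && (w != w0)) F w.
  by apply: sumr_ge0 => w /andP[/F0/ltW].
have Fw0 : F w0 = b by apply/eqP; rewrite eq_le bF andbT -Fb lerDl.
split=> // w /=; have [->//|ww0] := eqVneq w w0; apply/negP => Pw.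
move: Fb; rewrite Fw0 => /eqP; rewrite -subr_eq0 addrAC subrr add0r.
rewrite (bigD1 w) ?Pw //= gt_eqF // ltr_pwDl ?F0 //.
by apply: sumr_ge0 => w' /andP[/andP[/F0/ltW]].
Qed.

Section TailVector.
Variables (R : realType) (alpha : R) (d : nat) (t a : R).
Variables (T : finType) (G : rel T) (K : {set T}) (u : T) (h : T -> nat).
Let m := #|~: K|.
Let rho := alpha + (1 - alpha) * t.
Hypothesis alpha01 : 0 <= alpha < 1.
Hypothesis taP : perron_parameters alpha d m t a.
Hypothesis uK : u \in K.
Hypothesis Kd : #|K| = d.
Hypothesis GK : {in K &, forall v w, G v w = (v != w)}.
Hypothesis h0 : forall v, (h v == 0%N) = (v \in K).

Definition tail_vector (v : T) : R := if v == u then a else t ^- (h v).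

Lemma tail_vector_gt0 v : 0 < tail_vector v.
Proof.
have [t1 a1 _ _] := taP.
by rewrite /tail_vector; case: ifP => _; rewrite ?invr_gt0 ?exprn_gt0 //; lra.
Qed.

Lemma tail_vector_clique v : v \in K -> v != u -> tail_vector v = 1.
Proof.
by rewrite -h0 /tail_vector => /eqP -> /negbTE ->; rewrite expr0 invr1.
Qed.

Lemma tail_vector_out v : v \notin K -> tail_vector v = t ^- (h v).
Proof. by move=> vK; rewrite /tail_vector ifN //; apply: contraNneq vK => ->. Qed.

Let term v w := alpha * tail_vector v + (1 - alpha) * tail_vector w.

Lemma term_gt0 v w : 0 < term v w.
Proof.
have /andP[al0 al1] := alpha01.
rewrite ltr_wpDl ?mulr_gt0 ?subr_gt0 ?tail_vector_gt0 // mulr_ge0 //.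
by rewrite ltW // tail_vector_gt0.
Qed.

(** The last two equations of [perron_parameters] evaluate the sum inside [K]. The subtracted amount
    is what the arc from [v_1] to [v_2] contributes in [Bdigraph]; the final sum collects the arcs
    leaving [K]. *)
Lemma action_clique v : v \in K ->
  alpha_action alpha G tail_vector v =
  rho * tail_vector v - (if v == u then alpha * a + (1 - alpha) * t ^- m else 0)
   + \sum_(w | G v w && (w \notin K)) term v w.
Proof.
move=> vK; rewrite /alpha_action (bigID (mem K)) /=; congr (_ + _).
have [_ _ E1 E2] := taP.
have sK : \sum_(w in K) tail_vector w = a + (d%:R - 1).
  rewrite (bigD1 u) //= {1}/tail_vector eqxx.
  rewrite (eq_bigr (fun=> 1)) => [|w /andP[]]; last exact: tail_vector_clique.
  rewrite sumr_const -[d%:R]/(d%:R : R) -Kd (cardD1 u K) uK add1n -addn1 natrD addrK.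
  by congr (_ + _%:R); apply: eq_card => w; rewrite !inE andbC.
rewrite (eq_bigl (fun w => (w \in K) && (w != v))) => [|w]; last first.
  by case wK: (w \in K); rewrite ?andbF //= andbT GK // eq_sym.
have -> : \sum_(w in K | w != v) term v w =
  (\sum_(w in K) term v w) - term v v by rewrite [in RHS](bigD1 v) //= addrC addrK.
rewrite big_split /= sumr_const -mulr_sumr sK Kd -[_ *+ d]mulr_natr /term /rho.
case: eqP => [->|/eqP vu]; last by rewrite (tail_vector_clique vK vu); lra.
by rewrite /tail_vector eqxx; lra.
Qed.

(** Entries grow by the factor [t] on descending one step, so a single descending arc already
    accounts for [rho * tail_vector v]. *)
Lemma action_tail v y : v \notin K -> h v = (h y).+1 ->
  y != u -> term v y = rho * tail_vector v.
Proof.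
have [t1 _ _ _] := taP.
move=> vK hvy yu; rewrite /term (tail_vector_out vK) /tail_vector (negbTE yu) hvy.
have -> : t ^- h y = t * t ^- (h y).+1.
  by rewrite exprS invfM mulrA divff ?mul1r // gt_eqF //; lra.
by rewrite /rho; ring.
Qed.

(** The only arc leaving [K] goes from [u] to height [m] and exactly fills the deficit at [u];
    outside [K] the only arc descends. *)
Lemma alpha_action_tail_vector : clique_with_tail G K u h ->
  forall v, alpha_action alpha G tail_vector v = rho * tail_vector v.
Proof.
move=> [_ _ GKN GN [_ hinj [w0 w0K hw0]]] v; have [vK|vK] := boolP (v \in K).
  rewrite action_clique //.
  have [->|vu] := eqVneq v u; last first.
    by rewrite big_pred0 ?subr0 ?addr0 // => w; case: (boolP (w \in K)) => wK;
       rewrite ?andbF // GKN // (negbTE vu).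
  rewrite (big_pred1 w0) => [|w]; last first.
    case: (boolP (w \in K)) => wK; first by rewrite andbF; apply/esym/negP => /eqP ww;
       move: w0K; rewrite -ww wK.
    rewrite andbT GKN // eqxx -hw0 /=; apply/eqP/eqP => [|-> //].
    by apply: hinj; rewrite inE.
  by rewrite /term (tail_vector_out w0K) hw0 /tail_vector eqxx subrK.
have [y [yu hvy Gv]] := GN v vK.
by rewrite /alpha_action (big_pred1 y) //; exact: action_tail.
Qed.

Section Extremal.
Hypothesis hP : descent G K h.
Variable w0 : T.
Hypotheses (w0K : w0 \notin K) (Guw0 : G u w0).

(** The descending neighbour may be [u], whose entry is [a > 1] instead of [1]; the inequality is
    then strict, so equality excludes this case. *)
Lemma tail_vector_next v : v \notin K ->
  exists y, [/\ G v y, h v = (h y).+1, rho * tail_vector v <= term v y &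
                rho * tail_vector v = term v y -> y != u].
Proof.
have /andP[al0 al1] := alpha01; have [t1 a1 _ _] := taP.
have tn0 : t != 0 by rewrite gt_eqF //; lra.
move=> vK; have [h0' hS] := hP.
case hv: (h v) => [|k]; first by move: vK; rewrite -h0' hv.
have [y Gvy hy] := hS v k hv.
have [yu|yu] := eqVneq y u; last by exists y; rewrite action_tail ?hy.
have lt_y : rho * tail_vector v < term v y.
  rewrite /term (tail_vector_out vK) hv -hy yu.
  have /eqP -> : h u == 0%N by rewrite h0.
  rewrite /tail_vector eqxx /rho expr1 mulrDl -mulrA divff //.
  by rewrite ltrD2l ltr_pM2l ?subr_gt0.
exists y; rewrite hy; split=> //; first exact: ltW.
by move=> e; rewrite e ltxx in lt_y.
Qed.

(** Heights are at most [m] and [t > 1], so an arc from [u] to any [w0] outside [K] covers the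
    deficit at [u]. *)
Lemma term_head : alpha * a + (1 - alpha) * t ^- m <= term u w0.
Proof.
have /andP[al0 al1] := alpha01; have [t1 a1 _ _] := taP.
rewrite /term (tail_vector_out w0K) {1}/tail_vector eqxx lerD2l ler_pM2l ?subr_gt0 //.
have t0 : 0 < t by lra.
by rewrite lef_pV2 ?posrE ?exprn_gt0 // ler_eXn2l // (descent_leq hP).
Qed.

Lemma tail_vector_subaction v :
  rho * tail_vector v <= alpha_action alpha G tail_vector v.
Proof.
have [vK|vK] := boolP (v \in K).
  rewrite action_clique //; have [->|vu] := eqVneq v u; last first.
    by rewrite subr0 lerDl sumr_ge0 // => w _; rewrite ltW // term_gt0.
  rewrite (bigD1 w0) ?Guw0 //= -addrA lerDl addrA addr_ge0 //.
    by rewrite addrC subr_ge0 term_head.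
  by rewrite sumr_ge0 // => w _; rewrite ltW // term_gt0.
have [y [Gvy _ le_y _]] := tail_vector_next vK.
rewrite /alpha_action (bigD1 y) //= (le_trans le_y) // lerDl sumr_ge0 // => w _.
by rewrite ltW // term_gt0.
Qed.

Lemma tail_vector_rigid :
  (forall v, alpha_action alpha G tail_vector v = rho * tail_vector v) ->
  clique_with_tail G K u h.
Proof.
have /andP[al0 al1] := alpha01; have [t1 a1 _ _] := taP.
move=> actE.
have [hw0 Gu] : term u w0 = alpha * a + (1 - alpha) * t ^- m /\
    (fun w => G u w && (w \notin K)) =1 pred1 w0.
  apply: sumr_eq_single => [w _| | |]; first exact: term_gt0.
  - by rewrite Guw0.
  - exact: term_head.
  - have := actE u; rewrite action_clique // eqxx -addrA => /eqP.
    by rewrite -subr_eq0 addrAC subrr add0r addrC subr_eq0 => /eqP.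
(* Equality in [term_head] puts [w0] at the greatest possible height, which makes [h] injective
   outside [K]. *)
have {}hw0 : h w0 = m.
  move/eqP: hw0; rewrite /term (tail_vector_out w0K) {1}/tail_vector eqxx.
  have b0 : 1 - alpha != 0 by rewrite gt_eqF // subr_gt0.
  rewrite (inj_eq (addrI _)) (inj_eq (mulfI b0)).
  rewrite (inj_eq invr_inj) => /eqP; have t0 : 0 < t by lra.
  move=> e; apply/eqP; rewrite eqn_leq -!(ler_eXn2l t1).
  by rewrite -/m e lexx.
have hinj := descent_inj hP hw0.
split=> //; last by split=> //; exists w0.
- move=> v w vK wK; have [->|vu] := eqVneq v u.
    have := Gu w; rewrite /= wK andbT => ->; rewrite -/m -hw0.
    by apply/eqP/eqP => [-> //|]; apply: hinj; rewrite inE.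
  apply/negP => Gvw; have := actE v; rewrite action_clique // (negbTE vu) subr0.
  move=> /eqP; rewrite -subr_eq0 addrAC subrr add0r.
  rewrite (bigD1 w) ?Gvw //= gt_eqF // ltr_pwDl ?term_gt0 // sumr_ge0 // => w' _.
  by rewrite ltW // term_gt0.
- move=> v vK; have [y [Gvy hvy le_y yu]] := tail_vector_next vK.
  have [yE Gv] := sumr_eq_single (fun w _ => term_gt0 v w) Gvy le_y (actE v).
  by exists y; split=> //; apply: yu; rewrite yE.
Qed.

End Extremal.

End TailVector.

(** * Identifying a clique with a tail with B_{n,d} *)

Lemma clique_with_tail_iso (T : finType) (G : rel T) (K : {set T}) (u : T)
    (h : T -> nat) (n d : nat) :
  (2 <= d <= n - 1)%N -> #|T| = n -> #|K| = d ->
  clique_with_tail G K u h -> digraph_iso G (Bdigraph n d).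
Proof.
move=> dn Tn Kd [uK GK GKN GN [h0 hinj [w0 w0K hw0]]].
have mE : #|~: K| = (n - d)%N by have := cardsC K; lia.
set m := #|~: K| in mE GKN hw0.
have hP : descent G K h.
  split=> // v k hv; have vK : v \notin K by rewrite -h0 hv.
  have [y [_ hy Gv]] := GN v vK; exists y; first by rewrite Gv.
  by move: hy; rewrite hv => -[].
have hle v : v \notin K -> (1 <= h v <= m)%N.
  by move=> vK; rewrite (descent_leq hP) andbT lt0n h0.
have [v1 v1K hv1] : exists2 v, v \notin K & h v = 1%N.
  have /(_ 1%N) := @descent_iota _ _ _ _ hP w0.
  rewrite hw0 mem_iota => /(_ _)/mapP[|v]; first by lia.
  by rewrite mem_enum inE => vK hv; exists v.
(* The tail re-enters the clique at [k0], which plays the role of [v_{n-d+2}]. *)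
have [k0 [k0u hk0 Gv1]] := GN v1 v1K.
have k0K : k0 \in K by rewrite -h0; move: hk0; rewrite hv1 => -[<-].
pose s := k0 :: enum (K :\ u :\ k0).
have ss : size s = d.-1.
  rewrite /= -cardE; have := cardsD1 u K; have := cardsD1 k0 (K :\ u).
  by rewrite !inE k0u k0K uK Kd; lia.
have sP v : v \in K -> v != u -> v \in s.
  by move=> vK vu; rewrite inE mem_enum !inE vK vu !andbT orbN.
(* The vertex [u] becomes ordinal 0, the tail fills [1, ..., m] by decreasing height, and [k0],
   first in [s], gets [m.+1], followed by the rest of the clique. *)
pose g v := if v == u then 0%N else
  if v \in K then (m.+1 + index v s)%N else (m.+1 - h v)%N.
have gu : g u = 0%N by rewrite /g eqxx.
have gK v : v \in K -> v != u -> g v = (m.+1 + index v s)%N.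
  by move=> vK /negbTE vu; rewrite /g vu vK.
have gN v : v \notin K -> g v = (m.+1 - h v)%N.
  by move=> vK; rewrite /g (negbTE vK) ifN //; apply: contraNneq vK => ->.
have isK v : v \in K -> v = u \/ v != u /\ (m.+1 <= g v < n)%N.
  move=> vK; have [|vu] := eqVneq v u; [by left|right]; split=> //.
  by rewrite gK //; have := sP v vK vu; rewrite -index_mem ss; lia.
have gn v : (g v < n)%N.
  have [/isK[->|[]]|vK] := boolP (v \in K); [rewrite gu; lia|lia|].
  by rewrite gN //; have := hle v vK; lia.
have ginj : injective g.
  move=> v w; have [vK|vK] := boolP (v \in K); have [wK|wK] := boolP (w \in K).
  - have [->|[vu gv]] := isK v vK; have [->|[wu gw]] := isK w wK; rewrite ?gu //.
    + by lia.
    + by lia.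
    + rewrite (gK v) // (gK w) // => /addnI e.
      by rewrite -(nth_index k0 (sP v vK vu)) e nth_index ?sP.
  - rewrite (gN w) //; have := hle w wK.
    by have [->|[vu]] := isK v vK; rewrite ?gu; lia.
  - rewrite (gN v) //; have := hle v vK.
    by have [->|[wu]] := isK w wK; rewrite ?gu; lia.
  - rewrite !gN // => e; apply: hinj; rewrite ?inE //.
    by have := hle v vK; have := hle w wK; lia.
have gk0 v : v \in K -> (g v == m.+1) = (v == k0).
  have gk : g k0 = m.+1 by rewrite gK //= eqxx addn0.
  by move=> vK; rewrite -gk (inj_eq ginj).
pose f v : 'I_n := Ordinal (gn v).
have finj : injective f by move=> v w /(congr1 val); exact: ginj.
exists f; first by apply: inj_card_bij; rewrite // card_ord Tn.
move=> v w; rewrite /Bdigraph (inj_eq finj) /=.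
have inKE x : (g x == 0%N) || (n - d + 2 <= (g x).+1)%N = (x \in K).
  have [xK|xK] := boolP (x \in K).
    by have [->|[_ gx]] := isK x xK; rewrite ?gu //; lia.
  by rewrite gN //; have := hle x xK; lia.
rewrite !inKE.
have [vK|vK] := boolP (v \in K);
  have [wK|wK] := boolP (w \in K); rewrite /= ?andbT ?andbF /=.
(* A path arc of [Bdigraph] never joins two clique vertices: it starts at 0 and ends at [1 <= m], or
   starts in the tail. *)
- rewrite GK // orbC; case: eqP => //= gw; rewrite [(_ <= _)%N]negbTE //.
  have [vu|[vu gv]] := isK v vK; have [wu|[wu gw']] := isK w wK;
    by subst; rewrite ?gu in gw *; lia.
- rewrite GKN // (gN w) //; have := hle w wK.
  have [->|[vu gv]] := isK v vK; first by rewrite gu eqxx /=; lia.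
  by rewrite (negbTE vu); lia.
- have [y [yu hvy Gv]] := GN v vK; rewrite Gv (gN v) //; have := hle v vK => hv.
  (* Only the tail vertex of height 1 has an arc into [K], and that arc ends at [k0]. *)
  have [hv1'|hv1'] := eqVneq (h v) 1%N.
    have vv1 : v = v1 by apply: hinj; rewrite ?inE ?hv1.
    have <- : k0 = y by apply/eqP; rewrite -Gv vv1 Gv1.
    by rewrite -gk0 //; lia.
  have yK : y \notin K by rewrite -h0; lia.
  have -> : (w == y) = false by apply: contraNF yK => /eqP <-.
  by have [->|[wu gw]] := isK w wK; rewrite ?gu; lia.
- have [y [yu hvy Gv]] := GN v vK; rewrite Gv (gN v) // (gN w) //.
  have := hle v vK; have := hle w wK => hw hv.
  apply/idP/eqP => [e|we]; last by rewrite we in hw *; lia.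
  have yK : y \notin K by rewrite -h0; lia.
  by apply: hinj; rewrite ?inE //; lia.
Qed.

(** * B_{n,d} as a clique with a tail *)

Definition Bclique (n d : nat) : {set 'I_n} :=
  [set i : 'I_n | (i == 0%N :> nat) || (n - d < i)%N].

(** Off the clique, the number of steps along the path to [v_{n-d+2}], which is the ordinal
    [(n - d).+1]. *)
Definition Bheight (n d : nat) (i : 'I_n) : nat :=
  (if i \in Bclique n d then 0 else (n - d).+1 - i)%N.
Arguments Bheight n d : clear implicits.

Lemma card_BcliqueC (n d : nat) :
  (2 <= d <= n - 1)%N -> #|~: Bclique n d| = (n - d)%N.
Proof.
move=> dn; have fn (j : 'I_(n - d)) : (j.+1 < n)%N by have := ltn_ord j; lia.
pose f j := Ordinal (fn j).
have finj : injective f by move=> i j /(congr1 val) [] /val_inj.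
rewrite -[RHS]card_ord -cardsT -(card_imset _ finj); apply: eq_card => i.
rewrite !inE; apply/idP/imsetP => [iK|[j _ ->] /=]; last by have := ltn_ord j; lia.
have im : (i.-1 < n - d)%N by lia.
by exists (Ordinal im) => //; apply: val_inj => /=; lia.
Qed.

Lemma Bdigraph_clique_with_tail (n d : nat) (u : 'I_n) :
  (2 <= d <= n - 1)%N -> u = 0%N :> nat ->
  clique_with_tail (Bdigraph n d) (Bclique n d) u (Bheight n d).
Proof.
move=> dn u0; have mE := card_BcliqueC dn.
have inKE (i : 'I_n) : (i == 0%N :> nat) || (n - d + 2 <= i.+1)%N = (i \in Bclique n d).
  by rewrite inE addn2 ltnS.
have BE i j : Bdigraph n d i j = [&& i != j, i \in Bclique n d & j \in Bclique n d] ||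
    ((j == i.+1 :> nat) && (j.+1 <= n - d + 2)%N).
  by rewrite /Bdigraph !inKE.
have valE (i j : 'I_n) : (i == j) = (i == j :> nat) by [].
have hN i : i \notin Bclique n d -> Bheight n d i = ((n - d).+1 - i)%N.
  by move=> iK; rewrite /Bheight (negbTE iK).
have KN i : i \notin Bclique n d -> (1 <= i <= n - d)%N by rewrite inE; lia.
split.
- by rewrite inE u0.
- move=> i j iK jK; rewrite BE iK jK /= andbT valE; move: iK jK; rewrite !inE; lia.
- move=> i j iK jK; rewrite BE (negbTE jK) !andbF /= valE mE hN // u0.
  by have := KN j jK; move: iK; rewrite inE; lia.
- move=> i iK; have := KN i iK => i1; have i1n : (i.+1 < n)%N by lia.
  exists (Ordinal i1n); split; first by rewrite valE u0.
    rewrite hN // /Bheight inE /=; case: ifP; lia.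
  by move=> j; rewrite BE (negbTE iK) andbF /= valE /=; lia.
- split.
  + by move=> i; rewrite /Bheight; case: ifP => // /negbT /KN; lia.
  + move=> i j; rewrite !inE => iK jK; rewrite !hN ?inE // => e.
    by apply: val_inj => /=; lia.
  (* The greatest height is attained at ordinal 1, that is [v_2]. *)
  + have n1 : (1 < n)%N by lia.
    by exists (Ordinal n1); rewrite ?hN ?inE ?mE /=; lia.
Qed.

(** * Comparison of a strongly connected digraph with B_{n,d} *)

Theorem theorem4p1 (R : realType) (alpha : R) (n d : nat)
    (T : finType) (G : rel T) :
  0 <= alpha < 1 ->
  (2 <= d <= n - 1)%N ->
  #|T| = n ->
  irreflexive G ->
  strongly_connected G ->
  clique_number G = d ->
  lambda alpha (Bdigraph n d) <= lambda alpha G /\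
  (lambda alpha G = lambda alpha (Bdigraph n d) <->
   digraph_iso G (Bdigraph n d)).
Proof.
move=> al dn Tn Girr Gsc Gd.
have T0 : (0 < #|T|)%N by rewrite Tn; lia.
have [K Kcl Kd] : exists2 K : {set T}, clique G K & #|K| = d.
  have [|K Kcl KE] := @eq_bigmax_cond _ (clique G) (fun S : {set T} => #|S|).
    by apply/card_gt0P; exists set0; apply/forall_inP => v; rewrite inE.
  by exists K => //; rewrite -KE -Gd.
have GK : {in K &, forall v w, G v w = (v != w)}.
  move=> v w vK wK; have [<-|vw] := eqVneq v w; first exact: Girr.
  by have /forall_inP/(_ v vK)/forall_inP/(_ w wK) := Kcl; rewrite vw.
have KC : #|~: K| = (n - d)%N by have := cardsC K; lia.
have K0 : K != set0 by rewrite -card_gt0 Kd; lia.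
have [h hP] := exists_descent Gsc K0.
have [u [w0 [uK w0K Guw0]]] : exists u w0, [/\ u \in K, w0 \notin K & G u w0].
  apply: strongly_connected_exit => //; apply: contraTneq dn => KT.
  by move: Kd; rewrite KT cardsT Tn; lia.
have [t [a taP]] := @exists_perron_parameters _ _ d (n - d) al ltac:(lia).
have n0 : (0 < n)%N by lia.
pose z := Ordinal n0.
(* On B_{n,d} the test vector is an exact eigenvector, so its eigenvalue bounds [lambda] from above;
   on [G] the same number is a lower bound. *)
have lB : lambda alpha (Bdigraph n d) <= alpha + (1 - alpha) * t.
  have Bct := @Bdigraph_clique_with_tail n d z dn erefl.
  have BK : #|Bclique n d| = d.
    by have := cardsC (Bclique n d); rewrite card_BcliqueC // card_ord; lia.
  have taB : perron_parameters alpha d #|~: Bclique n d| t a by rewrite card_BcliqueC.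
  have [zK BE _ _ [Bh0 _ _]] := Bct.
  apply: (lambda_le_superaction al _ (tail_vector_gt0 z (Bheight n d) taB)) => [|v].
    by rewrite card_ord.
  by rewrite (alpha_action_tail_vector taB zK BK BE Bh0 Bct).
have taP' : perron_parameters alpha d #|~: K| t a by rewrite KC.
have x0 := tail_vector_gt0 u h taP'.
have h0 := hP.1.
have xsub := tail_vector_subaction al taP' uK Kd GK h0 hP w0K Guw0.
have [lG lGeq] := lambda_ge_subaction al T0 Gsc x0 xsub.
split; first exact: le_trans lG.
(* If the two values agree, [lambda alpha G] is at most the common bound, so the test inequality on
   [G] is an equality everywhere and rigidity applies. *)
split=> [lGB|]; last exact: lambda_iso.
apply: (@clique_with_tail_iso _ _ K u h) => //.
apply: (tail_vector_rigid al taP' uK Kd GK h0 hP w0K Guw0).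
by apply: lGeq; rewrite lGB.
Qed.
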